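(* Let the initial datum $\rho_0\in \mathrm{L}^\infty(\mathbb{R};\mathbb{R}_+)$. If the CFL condition $$\frac{\Delta t}{\Delta x}\le \min\left\{\frac{8-27\alpha}{27\|\partial_\rho f\|},\ \frac{2}{27\|\partial_\rho f\|},\ \frac{\alpha}{\|\partial_\rho f\|}\right\}$$ holds, then there exists a constant $C$ such that the approximate solutions $\rho_\Delta$ computed using the MUSCL-Hancock-type scheme described in the context satisfy the $\mathrm{L}^\infty$ estimate $$\|\rho_\Delta(t,\cdot)\|\le C\qquad\text{for all } t\in[0,T].$$
   Context: Notation: $\mathbb{R}_+=[0,\infty)$; $\|\cdot\|$ denotes the $\mathrm{L}^\infty$ norm (for $\partial_\rho f$ over $\mathbb{R}\times\mathbb{R}$, for $\rho_\Delta(t,\cdot)$ over $\mathbb{R}$). $T>0$ is fixed. Problem: $\partial_t\rho+\partial_x f(\rho,A(t,x))=0$ on $(0,\infty)\times\mathbb{R}$, $\rho(0,x)=\rho_0(x)$, where $A(t,x)=\int_{\mathbb{R}}\mu(x-y)\rho(t,y)\,dy$. Standing hypotheses on $f=f(\rho,A):\mathbb{R}\times\mathbb{R}\to\mathbb{R}$ and $\mu:\mathbb{R}\to\mathbb{R}$: $f\in \mathrm{C}^2(\mathbb{R}\times\mathbb{R};\mathbb{R})$, $\partial_\rho f\in \mathrm{L}^\infty(\mathbb{R}\times\mathbb{R};\mathbb{R})$, $f(0,A)=0$ for all $A\in\mathbb{R}$; there is $M>0$ with $|\partial_A f(\rho,A)|,\ |\partial^2_{AA}f(\rho,A)|\le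 M|\rho|$ for all $\rho,A$; $\partial_\rho f\in \mathrm{W}^{1,\infty}(\mathbb{R}\times\mathbb{R};\mathbb{R})$; $\mu\in (\mathrm{C}_c^2\cap \mathrm{W}^{2,\infty})(\mathbb{R};\mathbb{R})$. Scheme. Fix $\theta\in[0,\tfrac12]$, $\alpha\in(0,\tfrac{8}{27})$, mesh size $\Delta x>0$, time step $\Delta t>0$, $\lambda=\Delta t/\Delta x$, $x_j=j\Delta x$, $x_{j+1/2}=x_j+\Delta x/2$, $t^n=n\Delta t$, $\mu_j=\mu(j\Delta x)$ ($j\in\mathbb{Z}$, $n\in\mathbb{N}\cup\{0\}$). Set $\rho^0_j=\frac1{\Delta x}\int_{x_{j-1/2}}^{x_{j+1/2}}\rho_0(x)\,dx$. Given $(\rho^n_j)_{j\in\mathbb{Z}}$: (1) Slopes: $\sigma^n_j=2\theta\,\mathrm{minmod}\big(\rho^n_j-\rho^n_{j-1},\ \tfrac12(\rho^n_{j+1}-\rho^n_{j-1}),\ \rho^n_{j+1}-\rho^n_j\big)$, where minmod of several numbers is $0$ unless all are nonzero with the same sign, in which case it is the one of smallest absolute value. Face values: $\rho^{n,-}_{j+1/2}=\rho^n_j+\tfrac12\sigma^n_j$, $\rho^{n,+}_{j-1/2}=\rho^n_j-\tfrac12\sigma^n_j$. (2) Convolutions: $A^n_j=\Delta x\sum_{l\in\mathbb{Z}}\mu_{j-l}\rho^n_l$, $s^n_j=\theta(A^n_{j+1}-A^n_{j-1})$, $A^{n,-}_{j+1/2}=A^n_j+\tfrac12 s^n_j$,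 $A^{n,+}_{j-1/2}=A^n_j-\tfrac12 s^n_j$. (3) Mid-time values: $\rho^{n+1/2,-}_{j+1/2}=\rho^{n,-}_{j+1/2}-\tfrac{\lambda}{2}\delta^n_j$ and $\rho^{n+1/2,+}_{j-1/2}=\rho^{n,+}_{j-1/2}-\tfrac{\lambda}{2}\delta^n_j$, with $\delta^n_j=f(\rho^{n,-}_{j+1/2},A^{n,-}_{j+1/2})-f(\rho^{n,+}_{j-1/2},A^{n,+}_{j-1/2})$. (4) Mid-time convolution: $A^{n+1/2}_{j+1/2}=\tfrac{\Delta x}{2}\sum_{l\in\mathbb{Z}}\big[\mu_{j+1-l}\,\rho^{n+1/2,+}_{l-1/2}+\mu_{j-l}\,\rho^{n+1/2,-}_{l+1/2}\big]$. (5) Update: $\rho^{n+1}_j=\rho^n_j-\lambda\big[F^{n+1/2}_{j+1/2}-F^{n+1/2}_{j-1/2}\big]$, where $F^{n+1/2}_{j+1/2}=F(\rho^{n+1/2,-}_{j+1/2},\rho^{n+1/2,+}_{j+1/2},A^{n+1/2}_{j+1/2})$ and $F(u,v,A)=\tfrac12\big(f(u,A)+f(v,A)\big)-\tfrac{\alpha}{2\lambda}(v-u)$. Approximate solution: $\rho_\Delta(t,x)=\rho^n_j$ for $(t,x)\in[t^n,t^{n+1})\times[x_{j-1/2},x_{j+1/2})$, $n\in\mathbb{N}\cup\{0\}$, $j\in\mathbb{Z}$. *)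

(* Defs.v *)
From HB Require Import structures.
From mathcomp Require Import all_boot all_order all_algebra.
From mathcomp Require Import all_classical all_reals all_analysis.

Set Implicit Arguments.
Unset Strict Implicit.
Unset Printing Implicit Defensive.
Import Order.TTheory GRing.Theory Num.Theory.
Import numFieldNormedType.Exports.

Local Open Scope classical_set_scope.
Local Open Scope ring_scope.

Section function_spaces.
Context {R : realType}.

Definition leb1 : {measure set (measurableTypeR R) -> \bar R} :=
  @lebesgue_measure R.
Definition leb2 :
    {measure set (measurableTypeR R * measurableTypeR R) -> \bar R} :=
  (@lebesgue_measure R \x @lebesgue_measure R)%E.

(* The norm of L^oo as an extended real: +oo for a function that is not
   essentially bounded. *)
Definition Linfty_norm {d} {T : measurableType d}
    (nu : {measure set T -> \bar R}) (g : T -> R) : \bar R :=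
  'N[nu]_+oo[EFin \o g]%E.

Definition d1 (f : R * R -> R) : R * R -> R :=
  fun p => derive1 (fun x => f (x, p.2)) p.1.
Definition d2 (f : R * R -> R) : R * R -> R :=
  fun p => derive1 (fun y => f (p.1, y)) p.2.

(* [derive1] is total, so the existence of each derivative is required next to
   its continuity. *)
Fixpoint C_1D (k : nat) (g : R -> R) : Prop :=
  continuous g /\
  match k with
  | 0 => True
  | k'.+1 => (forall x, derivable g x 1) /\ C_1D k' (derive1 g)
  end.

Fixpoint C_2D (k : nat) (f : R * R -> R) : Prop :=
  continuous f /\
  match k with
  | 0 => True
  | k'.+1 =>
      (forall p : R * R, derivable (fun x => f (x, p.2)) p.1 1) /\
      (forall p : R * R, derivable (fun y => f (p.1, y)) p.2 1) /\
      C_2D k' (d1 f) /\ C_2D k' (d2 f)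
  end.

Definition compactly_supported {V : topologicalType} (g : V -> R) : Prop :=
  compact (closure [set x | g x != 0]).

Definition test_1D (phi : R -> R) : Prop :=
  (forall k, C_1D k phi) /\ compactly_supported phi.
Definition test_2D (phi : R * R -> R) : Prop :=
  (forall k, C_2D k phi) /\ compactly_supported phi.

Definition weak_deriv (u g : R -> R) : Prop := forall phi, test_1D phi ->
  \int[leb1]_x (u x * derive1 phi x) = - \int[leb1]_x (g x * phi x).
Definition weak_d1 (u g : R * R -> R) : Prop := forall phi, test_2D phi ->
  \int[leb2]_p (u p * d1 phi p) = - \int[leb2]_p (g p * phi p).
Definition weak_d2 (u g : R * R -> R) : Prop := forall phi, test_2D phi ->
  \int[leb2]_p (u p * d2 phi p) = - \int[leb2]_p (g p * phi p).

(* The Sobolev spaces W^{k,oo}. *)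
Fixpoint Winfty_1D (k : nat) (u : R -> R) : Prop :=
  u \in Lfun leb1 +oo%E /\
  match k with
  | 0 => True
  | k'.+1 => exists2 g, weak_deriv u g & Winfty_1D k' g
  end.

Fixpoint Winfty_2D (k : nat) (u : R * R -> R) : Prop :=
  u \in Lfun leb2 +oo%E /\
  match k with
  | 0 => True
  | k'.+1 => (exists2 g, weak_d1 u g & Winfty_2D k' g) /\
             (exists2 g, weak_d2 u g & Winfty_2D k' g)
  end.

End function_spaces.

Section scheme.
Context {R : realType}.

Definition minmod (a b c : R) : R :=
  if [&& 0 < a, 0 < b & 0 < c] then Num.min a (Num.min b c)
  else if [&& a < 0, b < 0 & c < 0] then Num.max a (Num.max b c)
  else 0.

Context (f : R * R -> R) (mu rho0 : R -> R) (theta alpha dx dt : R).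

Let lambda := dt / dx.
Let mu_ (j : int) : R := mu (j%:~R * dx).

Definition initial (j : int) : R :=
  dx^-1 * \int[leb1]_(x in `[j%:~R * dx - dx / 2, j%:~R * dx + dx / 2]) rho0 x.

(* Throughout, [r j] is rho^n_j. An interface quantity of index j+1/2 is
   indexed by j; the superscripts -, + are the suffixes [m], [p]. *)

Definition slope (r : int -> R) (j : int) : R :=
  2 * theta * minmod (r j - r (j - 1)) ((r (j + 1) - r (j - 1)) / 2)
                     (r (j + 1) - r j).

Definition rho_m (r : int -> R) (j : int) : R := r j + slope r j / 2.
Definition rho_p (r : int -> R) (j : int) : R :=
  r (j + 1) - slope r (j + 1) / 2.

(* A sum over a set is 0 by convention when infinitely many terms are nonzero;
   here only finitely many are, as mu is compactly supported. *)
Definition conv (r : int -> R) (j : int) : R :=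
  dx * \sum_(l \in [set: int]) (mu_ (j - l) * r l).

Definition conv_slope (r : int -> R) (j : int) : R :=
  theta * (conv r (j + 1) - conv r (j - 1)).
Definition A_m (r : int -> R) (j : int) : R := conv r j + conv_slope r j / 2.
Definition A_p (r : int -> R) (j : int) : R :=
  conv r (j + 1) - conv_slope r (j + 1) / 2.

Definition delta (r : int -> R) (j : int) : R :=
  f (rho_m r j, A_m r j) - f (rho_p r (j - 1), A_p r (j - 1)).
Definition rho_mid_m (r : int -> R) (j : int) : R :=
  rho_m r j - lambda / 2 * delta r j.
Definition rho_mid_p (r : int -> R) (j : int) : R :=
  rho_p r j - lambda / 2 * delta r (j + 1).

Definition A_mid (r : int -> R) (j : int) : R :=
  dx / 2 * \sum_(l \in [set: int])
    (mu_ (j + 1 - l) * rho_mid_p r (l - 1) + mu_ (j - l) * rho_mid_m r l).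

Definition num_flux (u v a : R) : R :=
  (f (u, a) + f (v, a)) / 2 - alpha / (2 * lambda) * (v - u).
Definition flux (r : int -> R) (j : int) : R :=
  num_flux (rho_mid_m r j) (rho_mid_p r j) (A_mid r j).

Definition update (r : int -> R) : int -> R :=
  fun j => r j - lambda * (flux r j - flux r (j - 1)).

Definition rho (n : nat) : int -> R := iter n update initial.

(* For t >= 0, [Num.truncn (t / dt)] is the n with t^n <= t < t^{n+1}. *)
Definition rho_Delta (t x : R) : R :=
  rho (Num.truncn (t / dt)) (Num.floor (x / dx + 1 / 2)).

Lemma rho_Delta_cell (n : nat) (j : int) (t x : R) : 0 < dx -> 0 < dt ->
  n%:R * dt <= t < n.+1%:R * dt ->
  j%:~R * dx - dx / 2 <= x < j%:~R * dx + dx / 2 ->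
  rho_Delta t x = rho n j.
Proof.
move=> dx0 dt0 /andP[tn tn1] /andP[xj xj1]; rewrite /rho_Delta; congr rho.
  apply: truncn_def; first by rewrite ler_pdivlMr// tn ltr_pdivrMr.
apply: floor_def; rewrite intrD.
have h : (1 / 2 : R) * dx = dx / 2 by rewrite mul1r mulrC.
have xE : x / dx + 1 / 2 = (x + dx / 2) / dx.
  by rewrite [RHS]mulrDl mulrAC mulfV// gt_eqF.
rewrite xE ler_pdivlMr// ltr_pdivrMr// mulrDl mul1r -lerBlDr xj/=.
by rewrite -ltrBrDr -addrA {2}(splitr dx) addrK.
Qed.

End scheme.

(* Main.v *)
Require Import Defs.
From HB Require Import structures.
From mathcomp Require Import all_boot all_order all_algebra.
From mathcomp Require Import all_classical all_reals all_analysis.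
From mathcomp Require Import measurable_realfun ess_sup_inf.
From mathcomp Require Import ring lra zify.

Set Implicit Arguments.
Unset Strict Implicit.
Unset Printing Implicit Defensive.
Import Order.TTheory GRing.Theory Num.Theory.
Import numFieldNormedType.Exports.

Local Open Scope classical_set_scope.
Local Open Scope ring_scope.

(** The maximum of the discrete solution grows in one step by a factor of at
    most [1 + 3 * dt * G], where [dx * G * w] bounds the change of the flux
    [f (w, .)] when the convolution moves by one cell ([update_le]). For a
    fixed second argument of the flux the new value does not exceed the
    maximum of the old ones; only the variation of the convolution can raise
    it, and as [f (0, .) = 0] it does so in proportion to [w].

    The point is to bound [G] uniformly in the mesh. For [dx >= 1] the trivial
    bound [`|f (w, a)| <= L * w] suffices. For [dx <= 1] the convolution moves
    by [O(dx)] times the mass of the solution in a window of the size of the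
    support of [mu]. The datum need not be integrable, and bounding that mass
    by the maximum would only give a quadratic growth inequality, which may
    blow up before [T]. The mass in a window must therefore be bounded
    independently of the maximum. A weighted sum does not do it either, because
    the numerical diffusion [alpha * dx ^ 2 / dt] is unbounded when [dt] is
    much smaller than [dx ^ 2], and its coefficient is rough as it depends on
    the slopes.

    The mass is controlled through the cumulative sum [U], with
    [r k = U k - U (k - 1)]. Nonnegativity ([update_ge0]) makes [U] monotone,
    and the conservative scheme for [r] becomes a nondivergence scheme for [U]:
    the new [U k] is a convex combination of [U (k - 1)], [U k], [U (k + 1)]
    whose mean displacement is at most [3 * lambda * L] cells, whatever the
    size of the diffusive weights ([cumulative_update]). An increment
    [U b - U a] is then an average of increments over pairs of points whose
    mean distance has grown by at most twice that drift. So the bound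
    [U b - U a <= B * (b - a) + c] is propagated with [c] growing at a rate
    proportional to [dt / dx] only ([increments_le_step]), which after
    multiplication by [dx] and summation over time is bounded on [0, T].
    This is the discrete form of coupling two one-dimensional diffusions: as
    they keep their order, their mean distance feels the drift alone. *)

(** * Limited reconstruction *)

(** A quantity that lies between two multiples of [w] is itself a multiple of
    [w], also when [w = 0]. This turns the estimates below into linear
    combinations with controlled coefficients. *)
Lemma between_multiples {R : realFieldType} (lo hi w z : R) :
  lo <= hi -> 0 <= w -> lo * w <= z <= hi * w ->
  exists2 x : R, lo <= x <= hi & z = x * w.
Proof.
move=> lohi w0 /andP[zlo zhi]; have [w00|wn0] := eqVneq w 0.
  exists lo; first by rewrite lexx.
  by apply/eqP; rewrite eq_le; move: zlo zhi; rewrite w00 !mulr0 => -> ->.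
have wp : 0 < w by rewrite lt_neqAle eq_sym wn0.
by exists (z / w); [rewrite ler_pdivlMr// ler_pdivrMr// zlo|rewrite divfK].
Qed.

Section reconstruction.
Context {R : realType} (theta : R) (theta_range : 0 <= theta <= 1 / 2).
Implicit Types (r : int -> R) (j : int).

(** The limiter as the estimates use it: a slope does not exceed the jumps of
    the cell averages on either side, and has their common sign. *)
Lemma slopeP r j :
  [\/ slope theta r j = 0,
      [/\ 0 <= slope theta r j, slope theta r j <= r j - r (j - 1)
        & slope theta r j <= r (j + 1) - r j]
    | [/\ slope theta r j <= 0, r j - r (j - 1) <= slope theta r j
        & r (j + 1) - r j <= slope theta r j]].
Proof.
have /andP[t0 t1] := theta_range.
rewrite /slope /minmod; case: ifPn => [/and3P[a0 b0 c0]|_].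
  constructor 2.
  set m := Num.min _ _.
  have m0 : 0 <= m by rewrite !le_min !ltW.
  have ma : m <= r j - r (j - 1) by rewrite ge_min lexx.
  have mc : m <= r (j + 1) - r j by rewrite !ge_min lexx !orbT.
  by split; nra.
case: ifPn => [/and3P[a0 b0 c0]|_]; last by constructor 1; rewrite mulr0.
constructor 3.
set m := Num.max _ _.
have m0 : m <= 0 by rewrite !ge_max !ltW.
have ma : r j - r (j - 1) <= m by rewrite le_max lexx.
have mc : r (j + 1) - r j <= m by rewrite !le_max lexx !orbT.
by split; nra.
Qed.

Lemma rho_pE r j : rho_p theta r (j - 1) = r j - slope theta r j / 2.
Proof. by rewrite /rho_p subrK. Qed.

Lemma face_sum r j : rho_m theta r j + rho_p theta r (j - 1) = 2 * r j.
Proof. by rewrite rho_pE /rho_m; ring. Qed.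

(** As [r] is nonnegative, a slope at most the jump to the smaller neighbour is
    at most [r j]; this keeps the face values comparable with [r j]. *)
Lemma face_bounds r j : (forall i, 0 <= r i) ->
  [/\ r j / 2 <= rho_m theta r j, rho_m theta r j <= 3 / 2 * r j,
      r j / 2 <= rho_p theta r (j - 1) & rho_p theta r (j - 1) <= 3 / 2 * r j].
Proof.
move=> r0; have := r0 j; have := r0 (j - 1); have := r0 (j + 1).
rewrite rho_pE /rho_m.
case: (slopeP r j) => [-> *|[*]|[*]]; split; lra.
Qed.

(** Each of the two slopes at an interface reduces the jump of the cell averages
    by at most one half of it, so the reconstruction keeps the sign of the jump.
    Hence the numerical viscosity acts as diffusion, possibly degenerate. *)
Lemma face_jump r k : exists2 kappa : R, 0 <= kappa <= 1 &
  rho_p theta r k - rho_m theta r k = kappa * (r (k + 1) - r k).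
Proof.
set d := r (k + 1) - r k; set e := rho_p theta r k - rho_m theta r k.
have he : (0 <= e <= d) \/ (d <= e <= 0).
  have := slopeP r (k + 1); have := slopeP r k.
  rewrite addrK -[r (k + 1) - r k]/d.
  have : e = d - (slope theta r k + slope theta r (k + 1)) / 2.
    by rewrite /e /d /rho_p /rho_m; field.
  move=> -> [h|[? ? ?]|[? ? ?]] [h'|[? ? ?]|[? ? ?]];
    rewrite ?h ?h'; case: (leP 0 d) => ?; ((left; lra) || (right; lra)).
case: he => [he|/andP[h1 h2]].
  by apply: between_multiples; [exact: ler01|lra|rewrite mul0r mul1r].
have [|||kappa hk ek] := @between_multiples R 0 1 (- d) (- e).
- exact: ler01.
- lra.
- by rewrite mul0r mul1r; lra.
by exists kappa => //; lra.
Qed.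

End reconstruction.

(** * Transport of the cumulative mass *)

Section cumulative_mass.
Context {R : realType}.
Implicit Types (U V r : int -> R) (B c : R).

(** End points may cross by two cells so that, after one step of stencil
    [k - 1, k, k + 1] at both end points, the bound is still available. *)
Definition increments_le B c U :=
  forall a b : int, a - 2 <= b -> U b - U a <= B * (b - a)%:~R + c.

(** [V k] is a convex combination of the values of [U] at [k - 1], [k], [k + 1]:
    [beta] is a diffusive weight, [ep] and [em] are drifts to either side, and
    only the drifts are bounded by the small parameter [e]. *)
Definition cumulative_step (e : R) U V := forall k, exists beta ep em : R,
  [/\ 0 <= beta, 0 <= ep, 0 <= em, [/\ ep <= e, em <= e & beta + e <= 1 / 2] &
   V k = U k + (beta + ep) * (U (k + 1) - U k)
             - (beta + em) * (U k - U (k - 1))].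

(** For a nondecreasing [U], crossed increments are nonpositive, and
    [c >= 2 * B] keeps the bound nonnegative for a crossing of two cells. *)
Lemma increments_le_mono B c U : 0 <= B -> 2 * B <= c ->
  (forall k, 0 <= U k - U (k - 1)) ->
  (forall a b : int, a <= b -> U b - U a <= B * (b - a)%:~R + c) ->
  increments_le B c U.
Proof.
move=> B0 Bc U0 UB a b ab; have [|ba] := leP a b; first exact: UB.
have [->|->] : b = a - 1 \/ b = a - 1 - 1 by lia.
  have -> : (a - 1 - a)%:~R = -1 :> R by rewrite addrAC subrr add0r.
  by have := U0 a; lra.
have -> : (a - 1 - 1 - a)%:~R = -2 :> R.
  by rewrite (_ : _ - a = -2)//; lia.
by have := U0 a; have := U0 (a - 1); lra.
Qed.

(** The increment [V b - V a] is the average of the increments of [U] over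
    independent displacements of [b] and [a]. The diffusive weights are
    symmetric and leave the mean distance unchanged; each drift adds at most
    [e]. *)
Lemma increments_le_step B c e U V : 0 <= B -> 2 * B <= c -> 0 <= e ->
  (forall k, 0 <= V k - V (k - 1)) ->
  cumulative_step e U V -> increments_le B c U ->
  increments_le B (c + 2 * e * B) V.
Proof.
have hm1 (a b : int) : a - 1 <= b -> a - 2 <= b - 1 by lia.
have hm0 (a b : int) : a - 1 <= b -> a - 2 <= b by lia.
have hp1 (a b : int) : a - 1 <= b -> a - 2 <= b + 1 by lia.
have km1 (a b : int) : a <= b -> a - 1 - 1 <= b by lia.
have km0 (a b : int) : a <= b -> a - 1 <= b by lia.
have kp1 (a b : int) : a <= b -> a + 1 - 1 <= b by lia.
move=> B0 Bc e0 V0 UV UB; apply: increments_le_mono => //; first by nra.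
(* Averaging over the displacement of the right end point only. *)
have half a b : a - 1 <= b -> V b - U a <= B * (b - a)%:~R + c + e * B.
  move=> ab; have h1 := UB a (b - 1) (hm1 _ _ ab).
  have h2 := UB a b (hm0 _ _ ab); have h3 := UB a (b + 1) (hp1 _ _ ab).
  have [beta [ep [em [b0 p0 m0 [pe me be] ->]]]] := UV b.
  move: h1 h2 h3; rewrite !(intrB, intrD) => h1 h2 h3.
  have := ler_wpM2l (addr_ge0 b0 m0) h1.
  have := ler_wpM2l (addr_ge0 b0 p0) h3.
  have q0 : 0 <= 1 - (beta + ep) - (beta + em) by lra.
  have := ler_wpM2l q0 h2.
  have := ler_wpM2r B0 pe.
  have := mulr_ge0 m0 B0.
  move: (U b) (U a) (U (b + 1)) (U (b - 1)) (b%:~R : R) (a%:~R : R).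
  by move=> ? ? ? ? ? ?; lra.
move=> a b ab; have h1 := half (a - 1) b (km1 _ _ ab).
have h2 := half a b (km0 _ _ ab); have h3 := half (a + 1) b (kp1 _ _ ab).
have [beta [ep [em [b0 p0 m0 [pe me be] ->]]]] := UV a.
move: h1 h2 h3; rewrite !(intrB, intrD) => h1 h2 h3.
have := ler_wpM2l (addr_ge0 b0 m0) h1.
have := ler_wpM2l (addr_ge0 b0 p0) h3.
have q0 : 0 <= 1 - (beta + ep) - (beta + em) by lra.
have := ler_wpM2l q0 h2.
have := ler_wpM2r B0 me.
have := mulr_ge0 p0 B0.
move: (V b) (U a) (U (a + 1)) (U (a - 1)) (b%:~R : R) (a%:~R : R).
by move=> ? ? ? ? ? ?; lra.
Qed.

(** A flux difference [P v - Q u] of nearly equal weights, taken between face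
    values [u = x r0] and [v = y r1] whose jump is a fraction of the jump
    [r1 - r0] of the cell averages, is diffusion plus a small upwind drift:
    the common part of [P] and [Q] multiplies [v - u], the excess
    multiplies the cell average from which it transports mass. *)
Lemma upwind_form (c P Q kappa x y r0 r1 : R) :
  0 <= c <= 2 / 27 -> 0 <= P <= 1 / 5 -> 0 <= Q <= 1 / 5 ->
  - (2 * c) <= P - Q <= 2 * c -> 0 <= kappa <= 1 ->
  0 <= x <= 3 / 2 -> 0 <= y <= 3 / 2 -> y * r1 - x * r0 = kappa * (r1 - r0) ->
  exists beta ep em : R,
  [/\ 0 <= beta, 0 <= ep, 0 <= em,
     [/\ ep <= 3 * c, em <= 3 * c & beta + 3 * c <= 1 / 2] &
   P * (y * r1) - Q * (x * r0) = (beta + ep) * r1 - (beta + em) * r0].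
Proof.
move=> /andP[c0 c1] P01 Q01 /andP[PQ1 PQ2] k01 x01 y01 jump.
have small (z w : R) : 0 <= z <= 1 -> 0 <= w <= 1 / 5 -> 0 <= w * z <= 1 / 5.
  move=> /andP[z0 z1] /andP[w0 w1]; rewrite mulr_ge0//=.
  by rewrite -[leRHS]mulr1 ler_pM.
have drift (z w : R) : 0 <= z <= 3 / 2 -> 0 <= w -> w <= 2 * c ->
    0 <= w * z <= 3 * c.
  move=> /andP[z0 z1] w0 w1; rewrite mulr_ge0//=.
  have -> : 3 * c = 2 * c * (3 / 2) by field.
  by rewrite ler_pM.
have c3 : 3 * c <= 3 / 10 by clear -c1; lra.
have c30 : 0 <= 3 * c by rewrite mulr_ge0.
have sum5 (b : R) : b <= 1 / 5 -> b + 3 * c <= 1 / 2 by clear -c3; lra.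
have [QP|/ltW PQ] := leP Q P.
- have /andP[b0 /sum5 b5] := small _ _ k01 Q01.
  have PQ0 : 0 <= P - Q by rewrite subr_ge0.
  have /andP[d0 d3] := drift _ _ y01 PQ0 PQ2.
  exists (Q * kappa), ((P - Q) * y), 0; split=> //.
  have -> : P * (y * r1) - Q * (x * r0)
          = Q * (y * r1 - x * r0) + (P - Q) * (y * r1) by ring.
  by rewrite jump; ring.
- have /andP[b0 /sum5 b5] := small _ _ k01 P01.
  have QP0 : 0 <= Q - P by rewrite subr_ge0.
  have QP2 : Q - P <= 2 * c by rewrite -opprB lerNl.
  have /andP[d0 d3] := drift _ _ x01 QP0 QP2.
  exists (P * kappa), 0, ((Q - P) * x); split=> //.
  have -> : P * (y * r1) - Q * (x * r0)
          = P * (y * r1 - x * r0) - (Q - P) * (x * r0) by ring.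
  by rewrite jump; ring.
Qed.

End cumulative_mass.

(** * One time step *)

Section one_step.
Context {R : realType} (f : R * R -> R) (mu : R -> R) (theta alpha dx dt L : R).
Context (theta_range : 0 <= theta <= 1 / 2).
Context (dx_gt0 : 0 < dx) (dt_gt0 : 0 < dt).
Context (f_0 : forall a, f (0, a) = 0).
Context (f_lip : forall x y a, `|f (x, a) - f (y, a)| <= L * `|x - y|).

(* The mesh ratio and the Courant number are variables, so that linear
   arithmetic treats them as single unknowns. *)
Context (lambda cfl : R) (lambdaE : dt / dx = lambda) (cflE : lambda * L = cfl).
Context (alpha_gt0 : 0 < alpha) (cfl_2_27 : cfl <= 2 / 27)
  (cfl_alpha : cfl <= alpha) (cfl_8_27 : alpha + cfl <= 8 / 27).

Local Notation sigma := (slope theta).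
Local Notation rm := (rho_m theta).
Local Notation rp := (rho_p theta).
Local Notation um := (rho_mid_m f mu theta dx dt).
Local Notation up := (rho_mid_p f mu theta dx dt).
Local Notation Am := (A_m mu theta dx).
Local Notation Ap := (A_p mu theta dx).
Local Notation Amid := (A_mid f mu theta dx dt).
Local Notation dlt := (delta f mu theta dx).
Local Notation upd := (update f mu theta alpha dx dt).
Local Notation flx := (flux f mu theta alpha dx dt).

Let lambda_gt0 : 0 < lambda. Proof. by rewrite -lambdaE divr_gt0. Qed.

Lemma lipschitz_ge0 : 0 <= L.
Proof.
by have := f_lip 1 0 0; rewrite subr0 normr1 mulr1; apply/le_trans/normr_ge0.
Qed.

Lemma cfl_ge0 : 0 <= cfl.
Proof. by rewrite -cflE mulr_ge0 ?lipschitz_ge0// ltW. Qed.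

(** Difference quotients of the flux turn flux differences into linear
    expressions with coefficients bounded by the Courant number [cfl]. *)
Lemma flux_quotient x y a : exists2 c : R, - cfl <= c <= cfl &
  lambda * (f (x, a) - f (y, a)) = c * (x - y).
Proof.
have [->|xy] := eqVneq x y.
  by exists 0; [have := cfl_ge0; lra|rewrite !subrr !mulr0].
have xy0 : x - y != 0 by rewrite subr_eq0.
exists (lambda * (f (x, a) - f (y, a)) / (x - y)); last by rewrite divfK.
rewrite -ler_norml normrM normfV ler_pdivrMr ?normr_gt0//.
rewrite normrM (gtr0_norm lambda_gt0) -cflE -mulrA.
by apply: ler_wpM2l; [exact: ltW lambda_gt0|exact: f_lip].
Qed.

Lemma flux_linear w a : exists2 c : R, - cfl <= c <= cfl &
  lambda * f (w, a) = c * w.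
Proof. by have [c] := flux_quotient w 0 a; rewrite f_0 !subr0; exists c. Qed.

Lemma mid_pE r j : up r (j - 1) = rp r (j - 1) - lambda / 2 * dlt r j.
Proof. by rewrite /rho_mid_p subrK lambdaE. Qed.

Section nonnegative.
Context (r : int -> R) (r_ge0 : forall j, 0 <= r j).

Lemma flux_bound w a : 0 <= w ->
  - (cfl * w) <= lambda * f (w, a) <= cfl * w.
Proof.
move=> w0; have [c /andP[c1 c2] ->] := flux_linear w a.
by rewrite -mulNr !ler_wpM2r.
Qed.

(** The two face values of a cell add up to twice the cell average, so the
    half-step corrections are of relative size [cfl]. *)
Lemma delta_bound j : - (2 * cfl * r j) <= lambda * dlt r j <= 2 * cfl * r j.
Proof.
have [] := face_bounds theta_range j r_ge0; have r0 := r_ge0 j => m1 m2 p1 p2.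
have /(flux_bound (Am r j)) : 0 <= rm r j by lra.
have /(flux_bound (Ap r (j - 1))) : 0 <= rp r (j - 1) by lra.
have : cfl * rm r j + cfl * rp r (j - 1) = 2 * cfl * r j.
  by rewrite -mulrDr (face_sum theta r j); ring.
rewrite /delta mulrBr; lra.
Qed.

Lemma mid_factors j : exists a b : R,
  [/\ 1 - 2 * cfl <= a <= 1 + 2 * cfl, 1 - 2 * cfl <= b <= 1 + 2 * cfl,
      um r j = a * rm r j & up r (j - 1) = b * rp r (j - 1)].
Proof.
have factor w : r j / 2 <= w -> exists2 a : R, 1 - 2 * cfl <= a <= 1 + 2 * cfl &
    w - lambda / 2 * dlt r j = a * w.
  move=> rw; have r0 := r_ge0 j; have /andP[d1 d2] := delta_bound j.
  have k0 := cfl_ge0; have krw := ler_wpM2l k0 rw.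
  by apply: between_multiples; lra.
have [m1 _ p1 _] := face_bounds theta_range j r_ge0.
have [a ha ea] := factor _ m1; have [b hb eb] := factor _ p1.
by exists a, b; rewrite mid_pE /rho_mid_m lambdaE.
Qed.

Lemma mid_bounds j :
  [/\ 0 <= um r j, 0 <= up r (j - 1), um r j <= 2 * r j
    & um r j + up r (j - 1) <= 3 * r j /\ up r (j - 1) <= 2 * r j].
Proof.
have [a [b [/andP[a1 a2] /andP[b1 b2] -> ->]]] := mid_factors j.
have := face_sum theta r j.
have [] := face_bounds theta_range j r_ge0; have r0 := r_ge0 j => m1 m2 p1 p2.
have k0 := cfl_ge0; have k1 := cfl_2_27 => s.
have m0 : 0 <= rm r j by lra.
have p0 : 0 <= rp r (j - 1) by lra.
have ha : 0 <= a <= 31 / 27 by lra.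
have hb : 0 <= b <= 31 / 27 by lra.
have := ler_wpM2r m0 (proj1 (andP ha)); have := ler_wpM2r m0 (proj2 (andP ha)).
have := ler_wpM2r p0 (proj1 (andP hb)); have := ler_wpM2r p0 (proj2 (andP hb)).
by move=> *; split; [| | |split]; lra.
Qed.

Lemma lambda_flux j : lambda * flx r j =
  (lambda * f (um r j, Amid r j) + lambda * f (up r j, Amid r j)) / 2
  - alpha / 2 * (up r j - um r j).
Proof.
by rewrite /flux /num_flux lambdaE; field; rewrite gt_eqF.
Qed.

(** The viscosity dominates the incoming fluxes because [cfl <= alpha]; the
    outgoing ones take at most [(alpha + cfl) / 2 * 3 <= 4 / 9] of the cell
    average. *)
Lemma update_ge0 j : 0 <= upd r j.
Proof.
rewrite /update lambdaE mulrBr !lambda_flux.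
have [m0 p0 _ [_ _]] := mid_bounds j.
have [m0' _ _ _] := mid_bounds (j - 1).
have [_ p0' _ [_ _]] := mid_bounds (j + 1).
move: p0'; rewrite addrK => p0'.
have := flux_bound (Amid r j) m0; have := flux_bound (Amid r j) p0'.
have := flux_bound (Amid r (j - 1)) p0.
have := flux_bound (Amid r (j - 1)) m0'.
have := ler_wpM2r m0' cfl_alpha; have := ler_wpM2r p0' cfl_alpha.
have s0 : 0 <= um r j + up r (j - 1) by lra.
have := ler_wpM2r s0 cfl_8_27.
have : um r j + up r (j - 1) <= 3 * r j by have [_ _ _ []] := mid_bounds j.
by have r0 := r_ge0 j; have a0 := alpha_gt0; move=> *; lra.
Qed.

(** Each mid-time value is its face value times a factor within [2 * cfl] of
    [1]; together with the quotients [f (w, a) / w], this perturbs the two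
    weights [alpha / 2] of the viscous flux by [O(cfl)] only; [upwind_form]
    applies to the resulting combination of face values. *)
Lemma cumulative_flux k : exists beta ep em : R,
  [/\ 0 <= beta, 0 <= ep, 0 <= em,
     [/\ ep <= 3 * cfl, em <= 3 * cfl & beta + 3 * cfl <= 1 / 2] &
   - (lambda * flx r k) = (beta + ep) * r (k + 1) - (beta + em) * r k].
Proof.
have [a [_ [/andP[a1 a2] _ ea _]]] := mid_factors k.
have [_ [b [_ /andP[b1 b2] _ eb]]] := mid_factors (k + 1).
have [_ _ p1 p2] := face_bounds theta_range (k + 1) r_ge0.
have [m1 m2 _ _] := face_bounds theta_range k r_ge0.
move: eb p1 p2; rewrite addrK => eb p1 p2.
have [x x01 ex] : exists2 x : R, 0 <= x <= 3 / 2 & rm r k = x * r k.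
  by have r0 := r_ge0 k; apply: between_multiples; lra.
have [y y01 ey] : exists2 y : R, 0 <= y <= 3 / 2 & rp r k = y * r (k + 1).
  by have r0 := r_ge0 (k + 1); apply: between_multiples; lra.
have [kappa k01] := face_jump theta_range r k; rewrite ex ey => jump.
have [cu /andP[cu1 cu2] ecu] := flux_linear (um r k) (Amid r k).
have [cv /andP[cv1 cv2] ecv] := flux_linear (up r k) (Amid r k).
have -> : - (lambda * flx r k) = (alpha - cv) / 2 * b * (y * r (k + 1))
                               - (alpha + cu) / 2 * a * (x * r k).
  by rewrite lambda_flux ecu ecv eb ea ex ey; field.
have c0 := cfl_ge0; have c1 := cfl_2_27; have c2 := cfl_alpha.
have c3 := cfl_8_27.
(* Here (alpha + cfl) / 2 <= 4 / 27 and 1 + 2 * cfl <= 31 / 27. *)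
have weight (c b' : R) : - cfl <= c <= cfl ->
    1 - 2 * cfl <= b' <= 1 + 2 * cfl ->
    `|(alpha + c) / 2 * (b' - 1)| <= 4 / 27 * (2 * cfl) /\
    0 <= (alpha + c) / 2 * b' <= 1 / 5.
  move=> /andP[? ?] /andP[? ?]; split.
    by rewrite normrM ler_pM// ler_norml; lra.
  have w0 : 0 <= (alpha + c) / 2 by lra.
  have b0 : 0 <= b' by lra.
  rewrite mulr_ge0//=; apply: (@le_trans _ _ (4 / 27 * (31 / 27))); last lra.
  by apply: ler_pM => //; lra.
have cv12 : - cfl <= - cv <= cfl by rewrite lerN2 lerNl cv1 cv2.
have [] := weight _ _ cv12 (introT andP (conj b1 b2)) => hb P01.
have cu12 : - cfl <= cu <= cfl by rewrite cu1 cu2.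
have [] := weight _ _ cu12 (introT andP (conj a1 a2)) => ha Q01.
apply: upwind_form x01 y01 jump => //; first by rewrite c0 c1.
have -> : (alpha - cv) / 2 * b - (alpha + cu) / 2 * a = - (cv + cu) / 2
    + (alpha - cv) / 2 * (b - 1) - (alpha + cu) / 2 * (a - 1) by field.
by move: ha hb; rewrite !ler_norml; lra.
Qed.

(** Summing the conservation form telescopes: the new cumulative sum is the old
    one minus [lambda] times the flux at the interface. *)
Lemma cumulative_update U : (forall k, r k = U k - U (k - 1)) ->
  exists V : int -> R, (forall k, upd r k = V k - V (k - 1)) /\
    cumulative_step (3 * cfl) U V.
Proof.
move=> rU; exists (fun k => U k - lambda * flx r k); split=> k.
  by rewrite /update lambdaE rU; ring.
have [beta [ep [em [b0 p0 m0 h E]]]] := cumulative_flux k.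
exists beta, ep, em; split=> //.
by rewrite E !rU addrK; ring.
Qed.

Lemma slope_le (m : R) j : (forall i, r i <= m) -> `|sigma r j| <= m - r j.
Proof.
move=> r_le; have := r_le j; have := r_le (j - 1); have := r_le (j + 1).
by rewrite ler_norml; case: (slopeP theta_range r j) => [->|[]|[]]; lra.
Qed.

(** The mid-time values move the face values along the slope, within the convex
    hull of the neighbouring cell averages, up to an error [eps] caused by the
    variation of the convolution across the cell. *)
Lemma mid_slope (G m : R) j : 0 <= G -> (forall i, r i <= m) ->
  (forall w, 0 <= w ->
     `|f (w, Am r j) - f (w, Ap r (j - 1))| <= dx * G * w) ->
  exists c eps : R, [/\ - cfl <= c <= cfl, `|eps| <= dt * G * m / 2,
    um r j = r j + (1 - c) / 2 * sigma r j - eps &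
    up r (j - 1) = r j - (1 + c) / 2 * sigma r j - eps].
Proof.
move=> G0 r_le AG; have [_ _ p1 p2] := face_bounds theta_range j r_ge0.
have p0 : 0 <= rp r (j - 1) by have := r_ge0 j; lra.
have pm : rp r (j - 1) <= m.
  by rewrite rho_pE; have := slope_le j r_le; have := r_le j;
     rewrite ler_norml => ? /andP[]; lra.
have [c hc ec] := flux_quotient (rm r j) (rp r (j - 1)) (Am r j).
exists c,
  (lambda * (f (rp r (j - 1), Am r j) - f (rp r (j - 1), Ap r (j - 1))) / 2).
have dE : lambda * dlt r j = c * sigma r j
    + lambda * (f (rp r (j - 1), Am r j) - f (rp r (j - 1), Ap r (j - 1))).
  have -> : sigma r j = rm r j - rp r (j - 1).
    by rewrite rho_pE /rho_m; field.
  by rewrite -ec /delta; ring.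
split=> //.
- rewrite normrM normfV (gtr0_norm (ltr0Sn _ _)) ler_wpM2r// normrM.
  rewrite (gtr0_norm lambda_gt0).
  apply: le_trans (ler_wpM2l (ltW lambda_gt0) (AG _ p0)) _.
  have -> : lambda * (dx * G * rp r (j - 1)) = dt * G * rp r (j - 1).
    by rewrite -lambdaE; field; rewrite gt_eqF.
  by rewrite ler_wpM2l// mulr_ge0// ltW.
- rewrite /rho_mid_m lambdaE.
  have -> : lambda / 2 * dlt r j = lambda * dlt r j / 2 by ring.
  by rewrite dE /rho_m; field.
- rewrite mid_pE.
  have -> : lambda / 2 * dlt r j = lambda * dlt r j / 2 by ring.
  by rewrite dE rho_pE; field.
Qed.

(** With the convolution fixed at its value on the left interface, the flux
    balance is split along the ordered states [um (j - 1)], [up (j - 1)],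
    [um j], [up j]: the jumps at the interfaces combine with the viscosity into
    nonnegative weights [P] and [Q], the jump inside the cell is the slope,
    which is at most [m - r j]. *)
Lemma update_le (G m : R) j : 0 <= G -> (forall i, r i <= m) ->
  (forall i w, 0 <= w ->
     `|f (w, Am r i) - f (w, Ap r (i - 1))| <= dx * G * w) ->
  (forall w, 0 <= w ->
     `|f (w, Amid r j) - f (w, Amid r (j - 1))| <= dx * G * w) ->
  upd r j <= m + 3 * (dt * G) * m.
Proof.
move=> G0 r_le AG AmidG.
have m0 : 0 <= m := le_trans (r_ge0 j) (r_le j).
have g0 : 0 <= dt * G by rewrite mulr_ge0// ltW.
have eta0 : 0 <= dt * G * m by rewrite mulr_ge0.
have c0 := cfl_ge0; have c1 := cfl_2_27; have c2 := cfl_alpha.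
have c3 := cfl_8_27; have a0 := alpha_gt0.
(* A point of the segment from x to x + s, perturbed by eps. *)
have hull (c eps s x : R) : - cfl <= c <= cfl -> `|eps| <= dt * G * m / 2 ->
    `|s| <= m - x -> x + (1 + c) / 2 * s - eps <= m + dt * G * m / 2.
  move=> /andP[? ?]; rewrite !ler_norml => /andP[e1 _] /andP[s1 s2].
  have q0 : 0 <= (1 + c) / 2 by lra.
  have q1 : 0 <= 1 - (1 + c) / 2 by lra.
  have := ler_wpM2l q0 s2.
  have := mulr_ge0 q1 (le_trans (normr_ge0 s) _ : 0 <= m - x).
  rewrite ler_norml s1 s2 => /(_ isT); lra.
have um_le i : um r i <= m + dt * G * m / 2.
  have [c [eps [hc he -> _]]] := mid_slope G0 r_le (AG i).
  have hc' : - cfl <= - c <= cfl by case/andP: hc; rewrite lerN2 lerNl => -> ->.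
  exact: hull hc' he (slope_le i r_le).
have up_le i : up r (i - 1) <= m + dt * G * m / 2.
  have [c [eps [hc he _ ->]]] := mid_slope G0 r_le (AG i).
  have := hull c eps (- sigma r i) (r i) hc he; rewrite normrN mulrN.
  by apply; exact: slope_le.
have [c [eps [hc he um_j up_j]]] := mid_slope G0 r_le (AG j).
have jump : um r j - up r (j - 1) = sigma r j by rewrite um_j up_j; field.
pose a := Amid r (j - 1).
have [k1 hk1 ek1] := flux_quotient (up r j) (um r j) a.
have [k2 hk2 ek2] := flux_quotient (um r j) (up r (j - 1)) a.
have [k3 hk3 ek3] := flux_quotient (up r (j - 1)) (um r (j - 1)) a.
pose E w := lambda * (f (w, Amid r j) - f (w, a)).
have E_le (w : R) : 0 <= w -> w <= 2 * m -> - E w <= 2 * (dt * G * m).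
  move=> w0 w2; apply: le_trans (ler_norm _) _.
  rewrite normrN /E normrM (gtr0_norm lambda_gt0).
  apply: le_trans (ler_wpM2l (ltW lambda_gt0) (AmidG _ w0)) _.
  have -> : lambda * (dx * G * w) = dt * G * w.
    by rewrite -lambdaE; field; rewrite gt_eqF.
  by have := ler_wpM2l g0 w2; lra.
have [um0 _ um2 _] := mid_bounds j.
have [_ up0 _ [_ up2]] := mid_bounds (j + 1).
move: up0 up2; rewrite addrK => up0 up2.
have Eu : - E (um r j) <= 2 * (dt * G * m).
  by apply: E_le => //; have := r_le j; lra.
have Ev : - E (up r j) <= 2 * (dt * G * m).
  by apply: E_le => //; have := r_le (j + 1); lra.
pose P := (alpha - k1) / 2; pose Q := (alpha + k3) / 2.
have updE : upd r j = r j - (E (um r j) + E (up r j)) / 2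
    + P * up r j + Q * um r (j - 1) - P * um r j - Q * up r (j - 1)
    - k2 * sigma r j.
  rewrite /update lambdaE mulrBr !lambda_flux -/a.
  move: ek1 ek2 ek3; rewrite jump !mulrBr => ek1 ek2 ek3.
  rewrite /P /Q /E; lra.
have P0 : 0 <= P by rewrite /P; lra.
have Q0 : 0 <= Q by rewrite /Q; lra.
have PQ : P + Q <= 8 / 27 by rewrite /P /Q; lra.
have hv : P * up r j <= P * (m + dt * G * m / 2).
  by apply: ler_wpM2l => //; have := up_le (j + 1); rewrite addrK.
have hu := ler_wpM2l Q0 (um_le (j - 1)).
have := slope_le j r_le => sm.
have ks : (Q * ((1 + c) / 2) - P * ((1 - c) / 2) - k2) * sigma r j
    <= 1 / 2 * (m - r j).
  apply: le_trans (ler_norm _) _; rewrite normrM ler_pM//.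
  have t0 (d : R) : - cfl <= d <= cfl -> 0 <= (1 + d) / 2 <= 1.
    by move=> /andP[? ?]; lra.
  have /andP[q0 q1] := t0 _ hc.
  have /t0/andP[p0 p1] : - cfl <= - c <= cfl.
    by case/andP: hc; rewrite lerN2 lerNl => -> ->.
  have := ler_wpM2l Q0 q1; have := ler_wpM2l P0 p1.
  have := mulr_ge0 Q0 q0; have := mulr_ge0 P0 p0.
  by move: hk2; rewrite ler_norml => /andP[? ?] *; lra.
have rest : (1 - (P + Q) - 1 / 2) * (m - r j) >= 0.
  by rewrite mulr_ge0 ?subr_ge0//; lra.
have he' : eps <= dt * G * m / 2 := le_trans (ler_norm _) he.
have PQ0 : 0 <= P + Q by rewrite addr_ge0.
have := ler_wpM2l PQ0 he'.
have := ler_wpM2r eta0 PQ.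
have eP := congr1 (fun z => P * z) um_j.
have eQ := congr1 (fun z => Q * z) up_j.
rewrite updE => e1 e2.
move: Eu Ev hv hu eP eQ ks rest e1 e2 eta0; rewrite {updE} /=.
move: (E _) (E _) (P * up r j) (Q * um r (j - 1)) (P * um r j).
move: (Q * up r (j - 1)) (r j) (sigma r j) => *; lra.
Qed.

End nonnegative.
End one_step.

(** * Essential bounds and Lipschitz constants *)

Section analysis.
Context {R : realType}.

Lemma derive1_lipschitz (g : R -> R) (K : R) : (forall x, derivable g x 1) ->
  (forall x, `|derive1 g x| <= K) ->
  forall x y, `|g x - g y| <= K * `|x - y|.
Proof.
move=> dg gK x y; wlog yx : x y / y <= x.
  by move=> h; have [/h//|/ltW/h] := leP y x; rewrite distrC [`|y - x|]distrC.
have [] := @MVT_segment R g (derive1 g) y x yx.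
- by move=> z _; rewrite derive1E; exact/derivableP.
- apply: continuous_subspaceT => z; apply: differentiable_continuous.
  exact/derivable1_diffP.
by move=> c _ ->; rewrite normrM ler_wpM2r.
Qed.

Lemma leb1_ball (x r : R) : 0 <= r -> leb1 (ball x r) = (r *+ 2)%:E.
Proof. exact: lebesgue_measure_ball. Qed.

Lemma leb1_setT_gt0 : (0 < leb1 [set: R])%E.
Proof.
have : (0 < leb1 (ball (0 : R)%R 1%R))%E.
  by rewrite leb1_ball// lte_fin.
by move/lt_le_trans; apply; apply: le_measure; rewrite ?inE//;
  exact: measurable_ball.
Qed.

Lemma measurable_ball2 (p : R * R) (e : R) :
  measurable (ball p e : set (measurableTypeR R * measurableTypeR R)).
Proof.
have -> : ball p e = ball p.1 e `*` ball p.2 e.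
  by apply/seteqP; split => q [].
by apply: measurableX; exact: measurable_ball.
Qed.

Lemma leb2_ball_gt0 (p : R * R) (e : R) : 0 < e -> (0 < leb2 (ball p e))%E.
Proof.
move=> e0; have -> : ball p e = ball p.1 e `*` ball p.2 e.
  by apply/seteqP; split => q [].
have -> : leb2 (ball p.1 e `*` ball p.2 e)
    = (leb1 (ball p.1 e) * leb1 (ball p.2 e))%E.
  by apply: product_measure1E; exact: measurable_ball.
rewrite !leb1_ball ?ltW// -EFinM lte_fin.
by rewrite mulr_gt0// pmulrn_lgt0.
Qed.

Lemma leb2_setT_gt0 : (0 < leb2 [set: R * R])%E.
Proof.
apply: (lt_le_trans (leb2_ball_gt0 0 ltr01)); apply: le_measure => //;
  rewrite inE//; exact: measurable_ball2.
Qed.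

Lemma Linfty_norm_ae {d} {T : measurableType d}
    (nu : {measure set T -> \bar R}) (g : T -> R) (L : R) :
  (0 < nu [set: T])%E -> (Linfty_norm nu g <= L%:E)%E ->
  {ae nu, forall x, `|g x| <= L}.
Proof.
move=> nu0; rewrite /Linfty_norm unlock nu0 => /ess_supP.
by apply: filterS => x /=; rewrite lee_fin.
Qed.

(** A continuous function is bounded everywhere by its essential bound, as
    non-empty open sets have positive measure. *)
Lemma Linfty_norm_continuous (g : R * R -> R) (L : R) : continuous g ->
  (Linfty_norm leb2 g <= L%:E)%E -> forall p, `|g p| <= L.
Proof.
move=> cg gL p; rewrite leNgt; apply/negP => Lp.
have : \forall q \near p, L < `|g q|.
  have cn : (fun q => `|g q|) @ p --> `|g p| by apply: cvg_norm; exact: cg.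
  exact: (cvgr_gt `|g p| cn).
case/nbhs_ballP => e /= e0 be.
have [N [mN N0 sN]] := Linfty_norm_ae leb2_setT_gt0 gL.
have := leb2_ball_gt0 p e0; apply/negP; rewrite -leNgt -N0.
apply: le_measure; rewrite ?inE//; first exact: measurable_ball2.
by move=> q /be/= Lq; apply: sN => /=; apply/negP; rewrite -ltNge.
Qed.

(** The derivative is bounded on the compact support by continuity and vanishes
    off it. *)
Lemma compactly_supported_lipschitz (mu : R -> R) : C_1D 2 mu ->
  compactly_supported mu -> exists K K1 : R,
  [/\ 0 <= K, 0 <= K1, forall x, K < `|x| -> mu x = 0
    & forall x y, `|mu x - mu y| <= K1 * `|x - y|].
Proof.
move=> [_ [dmu [cmu' _]]] comp.
have [K [Kr hK]] := compact_bounded comp.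
have [K1 [K1r hK1]] :=
  compact_bounded (continuous_compact (continuous_subspaceT cmu') comp).
exists (`|K| + 1), (`|K1| + 1); split; try by rewrite addr_ge0.
- move=> x xK; apply/eqP; apply/negPn/negP => mx.
  have /hK : K < `|K| + 1 by rewrite ltr_pwDr// ler_norm.
  move=> /(_ x (@subset_closure _ [set x | mu x != 0] x mx)) /=.
  by rewrite leNgt xK.
- apply: derive1_lipschitz => // x.
  have [cx|cx] := pselect (closure [set x | mu x != 0] x).
    have /hK1 : K1 < `|K1| + 1 by rewrite ltr_pwDr// ler_norm.
    by apply; exists x.
  have -> : derive1 mu x = 0; last by rewrite normr0 addr_ge0.
  rewrite derive1E.
  have nz : \forall y \near x, mu y = cst 0 y.
    have := open_nbhs_nbhs (conj (closed_openC (@closed_closure _ _)) cx).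
    apply: filterS => y cy; apply/eqP/negPn/negP => my.
    by apply: cy; exact: subset_closure.
  by rewrite (near_eq_derive _ nz) derive_cst.
Qed.

(** Clamping [rho0] to [[0, M0]] changes it on a null set only, so its cell
    averages are those of a function with values in [[0, M0]]. *)
Lemma initial_bounds (rho0 : R -> R) : rho0 \in Lfun leb1 +oo%E ->
  {ae leb1, forall x, 0 <= rho0 x} ->
  exists2 M0 : R, 0 <= M0 &
    forall dx j, 0 < dx -> 0 <= initial rho0 dx j <= M0.
Proof.
move=> /andP[]; rewrite !inE/= => mrho finrho rho_ge0.
have n0 : (0 <= Linfty_norm leb1 rho0)%E by exact: Lnorm_ge0.
have nfin : Linfty_norm leb1 rho0 \is a fin_num by rewrite ge0_fin_numE.
pose M0 := fine (Linfty_norm leb1 rho0).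
have M00 : 0 <= M0 by exact: fine_ge0.
have rho_le : {ae leb1, forall x, `|rho0 x| <= M0}.
  by apply: Linfty_norm_ae; rewrite ?leb1_setT_gt0// fineK.
exists M0 => // dx j dx0; rewrite /initial.
set I := (X in Rintegral _ X _).
have mI : measurable I by exact: measurable_itv.
have lI : leb1 I = dx%:E.
  rewrite -[LHS]/(@lebesgue_measure R I) lebesgue_measure_itv/= lte_fin ltrD2l.
  by rewrite gtrN ?divr_gt0// -EFinB; congr EFin; field.
pose g x := Num.max 0 (Num.min (rho0 x) M0).
have g01 x : 0 <= g x <= M0 by rewrite le_max lexx/= ge_max M00 ge_min lexx orbT.
have mg : measurable_fun I (EFin \o g).
  apply/measurable_EFinP; apply: (@measurable_funTS _ _ _ _ I).
  by apply: measurable_maxr => //; apply: measurable_minr.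
have -> : \int[leb1]_(x in I) rho0 x = \int[leb1]_(x in I) g x.
  congr fine; apply: ae_eq_integral => //.
    by apply/measurable_EFinP; exact: measurable_funTS.
  near=> x => /= Ix; congr EFin; rewrite /g min_l ?max_r//.
    by near: x.
  apply: le_trans (ler_norm _) _.
  by near: x.
have int_ge0 : 0 <= \int[leb1]_(x in I) g x.
  by apply: Rintegral_ge0 => x _; case/andP: (g01 x).
rewrite mulr_ge0 ?invr_ge0 ?(ltW dx0)//=.
rewrite ler_pdivrMl// mulrC -lee_fin.
have gM : (\int[leb1]_(x in I) (g x)%:E <= (M0 * dx)%:E)%E.
  rewrite EFinM -lI -integral_cst//.
  apply: ge0_le_integral => //.
  - by move=> x _; rewrite lee_fin; case/andP: (g01 x).
  - by move=> x _; rewrite lee_fin; case/andP: (g01 x).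
rewrite /Rintegral fineK// ge0_fin_numE.
  exact: le_lt_trans gM (ltry _).
by apply: integral_ge0 => x _; rewrite lee_fin; case/andP: (g01 x).
Unshelve. all: by end_near. Qed.

Lemma Linfty_norm_le (g : R -> R) (C : R) : 0 <= C -> (forall x, `|g x| <= C) ->
  (Linfty_norm leb1 g <= C%:E)%E.
Proof.
move=> C0 gC; rewrite /Linfty_norm unlock; case: ifPn => // _.
by apply/ess_supP; apply: aeW => x /=; rewrite lee_fin.
Qed.

End analysis.

(** * Variation of the discrete convolutions *)

Section convolution.
Context {R : realType}.
Implicit Types (g r U : int -> R) (a j k l : int).

Lemma sum_window g a n :
  (forall l, ~~ (a <= l < a + n%:Z) -> g l = 0) ->
  \sum_(l \in [set: int]) g l = \sum_(i < n) g (a + i%:Z).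
Proof.
move=> g0; rewrite (@fsbig_ord _ _ _ n (fun i => g (a + i%:Z))).
rewrite -(@fsbig_image _ _ _ _ _ `I_n (fun i : nat => a + i%:Z) g); last first.
  by move=> i i' _ _ /addrI[].
apply/esym/fsbig_widen => // l [_ nl]; apply: g0; apply/negP => /andP[al la].
by apply: nl; exists `|l - a|%N => /=; lia.
Qed.

Lemma sum_cumulative r U a n : (forall k, r k = U k - U (k - 1)) ->
  \sum_(i < n) r (a + i%:Z) = U (a + n%:Z - 1) - U (a - 1).
Proof.
move=> rU; elim: n => [|n IHn]; first by rewrite big_ord0 addr0 subrr.
rewrite big_ord_recr/= IHn rU.
by rewrite (_ : a + n.+1%:Z - 1 = a + n%:Z); [ring|lia].
Qed.

Lemma sum_diff_le g1 g2 r U a n (c : R) :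
  (forall k, r k = U k - U (k - 1)) ->
  (forall l, ~~ (a <= l < a + n%:Z) -> g1 l = 0 /\ g2 l = 0) ->
  (forall l, `|g1 l - g2 l| <= c * r l) ->
  `|\sum_(l \in [set: int]) g1 l - \sum_(l \in [set: int]) g2 l|
    <= c * (U (a + n%:Z - 1) - U (a - 1)).
Proof.
move=> rU g0 gr.
rewrite (sum_window (a := a) (n := n)) => [|l /g0[]//].
rewrite (sum_window (g := g2) (a := a) (n := n)) => [|l /g0[]//].
rewrite -sumrB -(sum_cumulative a n rU) mulr_sumr.
by apply: le_trans (ler_norm_sum _ _ _) _; apply: ler_sum.
Qed.

Lemma cumulative_exists r : exists U, forall k, r k = U k - U (k - 1).
Proof.
exists (fun k => match k with
  | Posz n => \sum_(i < n) r i.+1%:Z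
  | Negz n => - \sum_(i < n.+1) r (- i%:Z)
  end) => -[[|n]|n].
- by rewrite big_ord0 sub0r big_ord1 opprK oppr0.
- rewrite (_ : Posz n.+1 - 1 = Posz n); last by lia.
  by rewrite big_ord_recr/=; ring.
- rewrite (_ : Negz n - 1 = Negz n.+1); last by lia.
  rewrite [in X in _ - X]big_ord_recr/= (_ : - Posz n.+1 = Negz n)//.
  by ring.
Qed.

Lemma cumulative_le r U (B : R) : (forall k, r k = U k - U (k - 1)) ->
  (forall k, r k <= B) ->
  forall a b, a <= b -> U b - U a <= B * (b - a)%:~R.
Proof.
move=> rU rB a b ab; have [n ->] : exists n : nat, b = a + n%:Z.
  by exists `|b - a|%N; lia.
rewrite addrAC subrr add0r; elim: n => [|n IHn].
  by rewrite addr0 subrr mulr0.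
have := rU (a + n.+1%:Z); rewrite (_ : a + n.+1%:Z - 1 = a + n%:Z); last by lia.
have := rB (a + n.+1%:Z).
have -> : n.+1%:Z%:~R = n%:Z%:~R + 1 :> R by rewrite -addn1 PoszD intrD.
by move: IHn; lra.
Qed.

Context (mu : R -> R) (K K1 dx : R) (dx_gt0 : 0 < dx).
Context (mu_supp : forall x, K < `|x| -> mu x = 0) (K1_ge0 : 0 <= K1).
Context (mu_lip : forall x y, `|mu x - mu y| <= K1 * `|x - y|).
Context (N : nat) (KN : K < N%:R * dx).

Lemma mu_eq0 k : N%:Z <= `|k| -> mu (k%:~R * dx) = 0.
Proof.
move=> Nk; apply: mu_supp; apply: (lt_le_trans KN).
rewrite normrM (gtr0_norm dx_gt0) ler_wpM2r ?(ltW dx_gt0)//.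
by rewrite -intr_norm pmulrn ler_int.
Qed.

Lemma mu_diff k l : `|mu (k%:~R * dx) - mu (l%:~R * dx)|
  <= K1 * dx * `|(k - l)%:~R|.
Proof.
apply: le_trans (mu_lip _ _) _.
by rewrite -mulrBl normrM (gtr0_norm dx_gt0) intrB mulrA mulrAC.
Qed.

Lemma window_out j l : ~~ (j - N%:Z <= l < j - N%:Z + (2 * N + 1)%N%:Z) ->
  [/\ N%:Z <= `|j + 1 - l|, N%:Z <= `|j - l| & N%:Z <= `|j - 1 - l|].
Proof. by move=> h; split; lia. Qed.

(** Differences of the kernel are [O(dx)] by the Lipschitz bound and vanish off
    a window of [2 * N + 1] cells, so the mass of that window bounds the
    variation of the convolution. *)
Lemma conv_diff r U j : (forall k, 0 <= r k) ->
  (forall k, r k = U k - U (k - 1)) ->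
  `|Defs.conv mu dx r (j + 1) - Defs.conv mu dx r (j - 1)|
    <= dx * (2 * K1 * dx * (U (j + N%:Z) - U (j - N%:Z - 1))).
Proof.
move=> r0 rU; rewrite /Defs.conv -mulrBr normrM (gtr0_norm dx_gt0).
rewrite ler_wpM2l ?(ltW dx_gt0)//.
have -> : j + N%:Z = j - N%:Z + (2 * N + 1)%N%:Z - 1 by lia.
apply: sum_diff_le => // l.
  by case/window_out => h1 h2 h3; rewrite !mu_eq0// !mul0r.
rewrite -mulrBl normrM (ger0_norm (r0 l)) ler_wpM2r//.
apply: le_trans (mu_diff _ _) _.
rewrite (_ : j + 1 - l - (j - 1 - l) = 2); last by lia.
by rewrite [`|_|]ger0_norm//; lra.
Qed.

Lemma A_mid_diff (f : R * R -> R) theta dt r U j : (forall k, 0 <= r k) ->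
  (forall k, r k = U k - U (k - 1)) ->
  (forall k, 0 <= rho_mid_m f mu theta dx dt r k) ->
  (forall k, 0 <= rho_mid_p f mu theta dx dt r (k - 1)) ->
  (forall k, rho_mid_m f mu theta dx dt r k
             + rho_mid_p f mu theta dx dt r (k - 1) <= 3 * r k) ->
  `|A_mid f mu theta dx dt r j - A_mid f mu theta dx dt r (j - 1)|
    <= dx / 2 * (3 * K1 * dx * (U (j + N%:Z) - U (j - N%:Z - 1))).
Proof.
move=> r0 rU m0 p0 mp; rewrite /A_mid -mulrBr normrM.
have dx2 : 0 <= dx / 2 by rewrite divr_ge0 ?(ltW dx_gt0).
rewrite (ger0_norm dx2) ler_wpM2l//.
have -> : j + N%:Z = j - N%:Z + (2 * N + 1)%N%:Z - 1 by lia.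
apply: sum_diff_le => // l.
  by case/window_out => h1 h2 h3; rewrite subrK !mu_eq0// !mul0r !addr0.
set v := rho_mid_p _ _ _ _ _ _ _; set u := rho_mid_m _ _ _ _ _ _ _.
have v0 : 0 <= v := p0 l; have u0 : 0 <= u := m0 l.
rewrite subrK.
set m1 := mu ((j + 1 - l)%:~R * dx); set m2 := mu ((j - l)%:~R * dx).
set m3 := mu ((j - 1 - l)%:~R * dx).
have h1 : `|m1 - m2| <= K1 * dx.
  apply: le_trans (mu_diff _ _) _.
  by rewrite (_ : _ - _ = 1) ?normr1 ?mulr1//; lia.
have h2 : `|m2 - m3| <= K1 * dx.
  apply: le_trans (mu_diff _ _) _.
  by rewrite (_ : _ - _ = 1) ?normr1 ?mulr1//; lia.
have -> : m1 * v + m2 * u - (m2 * v + m3 * u) = (m1 - m2) * v + (m2 - m3) * u.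
  by ring.
apply: le_trans (ler_normD _ _) _; rewrite !normrM (ger0_norm v0) (ger0_norm u0).
apply: le_trans (lerD (ler_wpM2r v0 h1) (ler_wpM2r u0 h2)) _.
have -> : 3 * K1 * dx * r l = K1 * dx * (3 * r l) by ring.
rewrite -mulrDr ler_wpM2l ?mulr_ge0 ?(ltW dx_gt0)//.
by rewrite addrC; exact: mp.
Qed.

End convolution.

(** * Iteration in time *)

(** The least number [N] of cells that covers the support makes the window of
    length at most [2 * K + 3 * dx], hence the constant. *)
Lemma window_increment {R : realType} (U : int -> R) (B c K dx : R) (j : int) :
  0 <= B -> 0 <= K -> 0 < dx -> dx <= 1 -> increments_le B c U ->
  exists N : nat, K < N%:R * dx /\
    dx * (U (j + N%:Z) - U (j - N%:Z - 1)) <= B * (2 * K + 3) + dx * c.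
Proof.
have wide (k : int) (n : nat) : k - n.+1%:Z - 1 - 2 <= k + n.+1%:Z by lia.
have width (k : int) (n : nat) :
  k + n.+1%:Z - (k - n.+1%:Z - 1) = 2 * n%:Z + 3 by lia.
move=> B0 K0 dx0 dx1 UB; exists (Num.truncn (K / dx)).+1.
have := truncn_itv (divr_ge0 K0 (ltW dx0)); move: (Num.truncn _) => n.
rewrite ler_pdivlMr// ltr_pdivrMr// => /andP[n1 n2]; split=> //.
have := UB _ _ (wide j n); rewrite width intrD intrM -pmulrn => h.
apply: le_trans (ler_wpM2l (ltW dx0) h) _.
rewrite mulrDr lerD2r mulrCA ler_wpM2l//.
have -> : dx * (2 * n%:R + 3) = 2 * (n%:R * dx) + 3 * dx by ring.
by move: n1 dx1; lra.
Qed.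

(** The invariant increment bound of slope [M0] over a window that covers the
    support of the kernel, with the drift accumulated up to time [T]. *)
Definition local_mass_bound {R : realType} (L K M0 T : R) : R :=
  M0 * (2 * K + 3) + 2 * M0 + 6 * M0 * L * T.

(** The first summand serves coarse meshes, the second fine ones. *)
Definition growth_rate {R : realType} (L M K K1 M0 T : R) : R :=
  2 * L + M * (3 / 2 * K1 * local_mass_bound L K M0 T).

Section iteration.
Context {R : realType} (f : R * R -> R) (mu rho0 : R -> R).
Context (theta alpha dx dt L M K K1 M0 T : R).
Context (theta_range : 0 <= theta <= 1 / 2).
Context (dx_gt0 : 0 < dx) (dt_gt0 : 0 < dt).
Context (f_0 : forall a, f (0, a) = 0).
Context (f_lip : forall x y a, `|f (x, a) - f (y, a)| <= L * `|x - y|).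
Context (M_ge0 : 0 <= M).
Context (f_lipA : forall w a b, `|f (w, a) - f (w, b)| <= M * `|w| * `|a - b|).
Context (K_ge0 : 0 <= K) (K1_ge0 : 0 <= K1).
Context (mu_supp : forall x, K < `|x| -> mu x = 0).
Context (mu_lip : forall x y, `|mu x - mu y| <= K1 * `|x - y|).
Context (lambda cfl : R) (lambdaE : dt / dx = lambda) (cflE : lambda * L = cfl).
Context (alpha_gt0 : 0 < alpha) (cfl_2_27 : cfl <= 2 / 27)
  (cfl_alpha : cfl <= alpha) (cfl_8_27 : alpha + cfl <= 8 / 27).
Context (T_ge0 : 0 <= T) (M0_ge0 : 0 <= M0).
Context (initial_range : forall j, 0 <= initial rho0 dx j <= M0).

Local Notation S := (local_mass_bound L K M0 T).
Local Notation G := (growth_rate L M K K1 M0 T).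

Let L_ge0 : 0 <= L := lipschitz_ge0 f_lip.

Lemma local_mass_ge0 : 0 <= S.
Proof. by rewrite /local_mass_bound !addr_ge0 ?mulr_ge0 ?addr_ge0 ?mulr_ge0. Qed.

Lemma growth_rate_ge0 : 0 <= G.
Proof.
by have S0 := local_mass_ge0; rewrite /growth_rate addr_ge0 ?mulr_ge0 ?divr_ge0.
Qed.

(** On coarse meshes the size of the flux itself is small compared with
    [dx * w]; on fine ones the Lipschitz bound in the second argument is
    used. *)
Lemma flux_A_increment w a b : 0 <= w ->
  (dx <= 1 -> `|a - b| <= 3 / 2 * K1 * S * dx) ->
  `|f (w, a) - f (w, b)| <= dx * G * w.
Proof.
move=> w0 ab; have S0 := local_mass_ge0.
have G1 : 0 <= M * (3 / 2 * K1 * S) by rewrite !mulr_ge0 ?divr_ge0.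
have fw c : `|f (w, c)| <= L * w.
  by have := f_lip w 0 c; rewrite f_0 !subr0 (ger0_norm w0).
have [dx1|/ltW dx1] := leP dx 1.
  apply: le_trans (f_lipA _ _ _) _; rewrite (ger0_norm w0).
  apply: le_trans (ler_wpM2l (mulr_ge0 M_ge0 w0) (ab dx1)) _.
  have -> : M * w * (3 / 2 * K1 * S * dx)
          = dx * (M * (3 / 2 * K1 * S)) * w by ring.
  rewrite ler_wpM2r// /growth_rate ler_wpM2l ?(ltW dx_gt0)// lerDr.
  by rewrite mulr_ge0.
apply: le_trans (ler_normB _ _) _.
apply: le_trans (lerD (fw a) (fw b)) _.
rewrite -mulrDl ler_wpM2r//; apply: (@le_trans _ _ G).
  by rewrite /growth_rate; move: G1; lra.
by rewrite ler_peMl// growth_rate_ge0.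
Qed.

Lemma window_mass U c j : increments_le M0 c U -> dx <= 1 ->
  dx * c <= 2 * M0 + 6 * M0 * L * T ->
  exists N : nat, K < N%:R * dx /\
    dx * (U (j + N%:Z) - U (j - N%:Z - 1)) <= S.
Proof.
move=> UB dx1 dxc.
have [N [KN h]] := window_increment j M0_ge0 K_ge0 dx_gt0 dx1 UB.
exists N; split=> //; apply: le_trans h _.
by rewrite /local_mass_bound -[leRHS]addrA lerD2l.
Qed.

(** The increment bound does not involve the growing maximum: its slope stays
    the initial [M0], and each step adds [2 * (3 * cfl) * M0] to the constant,
    that is [6 * M0 * L * dt] after multiplication by [dx]. *)
Lemma rho_invariant n : n%:R * dt <= T ->
  (forall j, 0 <= rho f mu rho0 theta alpha dx dt n j
             <= M0 * (1 + 3 * (dt * G)) ^+ n) /\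
  exists U, (forall k, rho f mu rho0 theta alpha dx dt n k = U k - U (k - 1)) /\
    increments_le M0 (2 * M0 + 6 * M0 * cfl * n%:R) U.
Proof.
elim: n => [|n IHn] nT.
  split=> [j|]; first by rewrite expr0 mulr1; exact: initial_range.
  have [U rU] := cumulative_exists (initial rho0 dx); exists U; split=> //.
  apply: increments_le_mono => //; first by rewrite mulr0 addr0.
    by move=> k; rewrite -rU; case/andP: (initial_range k).
  move=> a b ab; apply: (@le_trans _ _ (M0 * (b - a)%:~R)).
    apply: cumulative_le ab; first exact: rU.
    by move=> k; case/andP: (initial_range k).
  by rewrite mulr0 addr0 lerDl mulr_ge0.
have nT' : n%:R * dt <= T.
  by apply: le_trans nT; rewrite ler_wpM2r ?(ltW dt_gt0)// ler_nat.
have [r_range [U [rU UB]]] := IHn nT'.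
rewrite /rho iterS -/(rho f mu rho0 theta alpha dx dt n).
move: (rho f mu rho0 theta alpha dx dt n) r_range rU => r r_range rU.
have r0 j : 0 <= r j by case/andP: (r_range j).
have m_ge0 := @update_ge0 R f mu theta alpha dx dt L theta_range dx_gt0 dt_gt0
  f_0 f_lip lambda cfl lambdaE cflE alpha_gt0 cfl_2_27 cfl_alpha cfl_8_27 r r0.
have cfl0 : 0 <= cfl := cfl_ge0 dx_gt0 dt_gt0 f_lip lambdaE cflE.
split; last first.
  have [V [rV UV]] := @cumulative_update R f mu theta alpha dx dt L theta_range
    dx_gt0 dt_gt0 f_0 f_lip lambda cfl lambdaE cflE cfl_2_27 cfl_alpha
    cfl_8_27 r r0 U rU.
  exists V; split=> //.
  have -> : 2 * M0 + 6 * M0 * cfl * n.+1%:R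
      = 2 * M0 + 6 * M0 * cfl * n%:R + 2 * (3 * cfl) * M0.
    by rewrite -natr1; ring.
  apply: increments_le_step UV UB => //.
  - by rewrite lerDl !mulr_ge0.
  - by rewrite mulr_ge0.
  - by move=> k; rewrite -rV.
move=> j; rewrite m_ge0/= exprSr mulrA.
set m := M0 * _ ^+ n.
have -> : m * (1 + 3 * (dt * G)) = m + 3 * (dt * G) * m by ring.
have mass i : dx <= 1 -> exists N : nat, K < N%:R * dx /\
    dx * (U (i + N%:Z) - U (i - N%:Z - 1)) <= S.
  move=> dx1; apply: (window_mass _ UB) => //.
  rewrite mulrDr; apply: lerD.
    by rewrite ler_piMl// mulr_ge0.
  have -> : dx * (6 * M0 * cfl * n%:R) = 6 * M0 * L * (n%:R * dt).
    by rewrite -cflE -lambdaE; field; rewrite gt_eqF.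
  by rewrite ler_wpM2l// !mulr_ge0.
have mb := @mid_bounds R f mu theta dx dt L theta_range dx_gt0 dt_gt0 f_0 f_lip
  lambda cfl lambdaE cflE cfl_2_27 r r0.
apply: (@update_le R f mu theta alpha dx dt L theta_range dx_gt0 dt_gt0
  f_0 f_lip lambda cfl lambdaE cflE alpha_gt0 cfl_2_27 cfl_alpha cfl_8_27 r r0).
- exact: growth_rate_ge0.
- by move=> i; case/andP: (r_range i).
- move=> i w w0; apply: flux_A_increment => // dx1.
  have [N [KN NS]] := mass i dx1.
  have -> : A_m mu theta dx r i - A_p mu theta dx r (i - 1) = theta *
      (Defs.conv mu dx r (i + 1) - Defs.conv mu dx r (i - 1)).
    by rewrite /A_m /A_p subrK /conv_slope; field.
  have /andP[t0 t1] := theta_range; rewrite normrM (ger0_norm t0).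
  have h := conv_diff dx_gt0 mu_supp K1_ge0 mu_lip KN i r0 rU.
  apply: le_trans (ler_pM t0 (normr_ge0 _) t1 h) _.
  have h2 := ler_wpM2l (mulr_ge0 K1_ge0 (ltW dx_gt0)) NS.
  have := mulr_ge0 (mulr_ge0 K1_ge0 (ltW dx_gt0)) local_mass_ge0.
  by move: h2; lra.
- move=> w w0; apply: flux_A_increment => // dx1.
  have [N [KN NS]] := mass j dx1.
  have := A_mid_diff dx_gt0 mu_supp K1_ge0 mu_lip KN j r0 rU
    (fun k => let: And4 h _ _ _ := mb k in h)
    (fun k => let: And4 _ h _ _ := mb k in h)
    (fun k => let: And4 _ _ _ (conj h _) := mb k in h).
  move/le_trans; apply.
  have h2 := ler_wpM2l (mulr_ge0 K1_ge0 (ltW dx_gt0)) NS.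
  by move: h2; lra.
Qed.

Lemma rho_le n : n%:R * dt <= T -> forall j,
  0 <= rho f mu rho0 theta alpha dx dt n j <= M0 * expR (3 * G * T).
Proof.
move=> nT j; have [/(_ j)/andP[-> h] _] := rho_invariant nT.
apply: le_trans h _; rewrite ler_wpM2l//.
have g0 : 0 <= 3 * (dt * G).
  by rewrite !mulr_ge0 ?(ltW dt_gt0)// growth_rate_ge0.
apply: (@le_trans _ _ (expR (3 * (dt * G)) ^+ n)).
  rewrite lerXn2r ?nnegrE ?expR_ge0 ?addr_ge0//; exact: expR_ge1Dx.
rewrite -expRM_natl ler_expR.
have -> : n%:R * (3 * (dt * G)) = 3 * G * (n%:R * dt) by ring.
by rewrite ler_wpM2l// mulr_ge0// growth_rate_ge0.
Qed.

End iteration.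

Lemma cfl_fin {R : realType} (lambda a y : R) : 0 <= a -> 0 <= y ->
  (lambda%:E <= a%:E / y%:E)%E -> lambda * y <= a.
Proof.
move=> a0 y0; rewrite inver; case: eqVneq => [->|yn0]; first by rewrite mulr0.
by rewrite -EFinM lee_fin ler_pdivlMr// lt_neqAle eq_sym yn0.
Qed.

Theorem theorem4p3 (R : realType) (T : R) (f : R * R -> R) (mu rho0 : R -> R)
    (theta alpha : R)
    (T_gt0 : 0 < T)
    (f_C2 : C_2D 2 f)
    (f_rho_Linfty : d1 f \in Lfun leb2 +oo%E)
    (f_0 : forall a : R, f (0, a) = 0)
    (f_A_bound : exists2 M : R, 0 < M & forall u a : R,
      `|d2 f (u, a)| <= M * `|u| /\ `|d2 (d2 f) (u, a)| <= M * `|u|)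
    (f_rho_W1infty : Winfty_2D 1 (d1 f))
    (mu_C2 : C_1D 2 mu)
    (mu_compact : compactly_supported mu)
    (mu_W2infty : Winfty_1D 2 mu)
    (theta_range : 0 <= theta <= 1 / 2)
    (alpha_range : 0 < alpha < 8 / 27)
    (rho0_Linfty : rho0 \in Lfun leb1 +oo%E)
    (rho0_ge0 : {ae leb1, forall x, 0 <= rho0 x}) :
  exists C : R, forall dx dt : R, 0 < dx -> 0 < dt ->
    (* In the extended reals, [a / 0 = +oo] for [a > 0]. *)
    ((dt / dx)%:E <=
       mine ((8 - 27 * alpha)%:E / (27%:E * Linfty_norm leb2 (d1 f)))
      (mine (2%:E / (27%:E * Linfty_norm leb2 (d1 f)))
            (alpha%:E / Linfty_norm leb2 (d1 f))))%E ->
    forall t : R, 0 <= t <= T ->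
      (Linfty_norm leb1 (rho_Delta f mu rho0 theta alpha dx dt t) <= C%:E)%E.
Proof.
have /andP[alpha_gt0 alpha_lt] := alpha_range.
have [_ [df1 [df2 [[cd1 _] _]]]] := f_C2.
have [M M_gt0 f_A] := f_A_bound.
have [K [K1 [K_ge0 K1_ge0 mu_supp mu_lip]]] :=
  compactly_supported_lipschitz mu_C2 mu_compact.
have [M0 M0_ge0 init] := initial_bounds rho0_Linfty rho0_ge0.
have norm_ge0 : (0 <= Linfty_norm leb2 (d1 f))%E by exact: Lnorm_ge0.
have norm_fin : Linfty_norm leb2 (d1 f) \is a fin_num.
  by rewrite ge0_fin_numE//; case/andP: f_rho_Linfty => _; rewrite inE.
pose L := fine (Linfty_norm leb2 (d1 f)).
have normE : Linfty_norm leb2 (d1 f) = L%:E by rewrite fineK.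
have L_ge0 : 0 <= L by exact: fine_ge0.
have f_lip x y a : `|f (x, a) - f (y, a)| <= L * `|x - y|.
  apply: (@derive1_lipschitz R (fun z => f (z, a))) => z.
    exact: (df1 (z, a)).
  by apply: (@Linfty_norm_continuous R (d1 f) L cd1 _ (z, a)); rewrite normE.
have f_lipA w a b : `|f (w, a) - f (w, b)| <= M * `|w| * `|a - b|.
  apply: (@derive1_lipschitz R (fun z => f (w, z))) => z.
    exact: (df2 (w, z)).
  by have [] := f_A w z.
exists (M0 * expR (3 * growth_rate L M K K1 M0 T * T)) => dx dt dx_gt0 dt_gt0.
rewrite normE -!EFinM !le_min => /and3P[c1 c2 c3] t /andP[t0 tT].
have {}c1 : 27 * (dt / dx * L) <= 8 - 27 * alpha.
  by rewrite mulrCA; apply: cfl_fin c1; rewrite ?mulr_ge0//; lra.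
have {}c2 : 27 * (dt / dx * L) <= 2.
  by rewrite mulrCA; apply: cfl_fin c2; rewrite ?mulr_ge0//; lra.
have {}c3 : dt / dx * L <= alpha by apply: cfl_fin c3 => //; exact: ltW.
have cfl_2_27 : dt / dx * L <= 2 / 27 by move: c2; lra.
have cfl_8_27 : alpha + dt / dx * L <= 8 / 27 by move: c1; lra.
have nT : (Num.truncn (t / dt))%:R * dt <= T.
  apply: le_trans tT; rewrite -ler_pdivlMr// truncn_le.
  by rewrite divr_ge0// ltW.
have bound := @rho_le R f mu rho0 theta alpha dx dt L M K K1 M0 T theta_range
  dx_gt0 dt_gt0 f_0 f_lip (ltW M_gt0) f_lipA K_ge0 K1_ge0 mu_supp mu_lip
  _ _ erefl erefl alpha_gt0 cfl_2_27 c3 cfl_8_27 (ltW T_gt0) M0_ge0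
  (fun j => init dx j dx_gt0) _ nT.
apply: Linfty_norm_le; first by rewrite mulr_ge0// expR_ge0.
move=> x; rewrite /rho_Delta.
by have /andP[? ?] := bound (Num.floor (x / dx + 1 / 2)); rewrite ger0_norm.
Qed.
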